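(* Let $s\ge 2$ be an integer, and let $p$ be a prime with $p\mid s$ such that $s$ is not a power of $p$. Then $\langle\mu_p,\sigma,\sigma^{-1}\rangle$ is an ID semigroup of $CAT(\Lambda_s^{\mathbb Z})$. In particular, $Aut(\Lambda_s^{\mathbb Z})$ is an ID semigroup whenever $s$ is not a power of a prime.
   Context: $\Lambda_s=\{0,1,\dots,s-1\}$ is the symbol set (discrete topology), and $\Lambda_s^{\mathbb Z}$ is the space of two-sided sequences with the product topology. $\sigma$ is the left shift, $\sigma(a)_k=a_{k+1}$. $CAT(\Lambda_s^{\mathbb Z})$ is the semigroup (under composition) of all continuous maps $\tau:\Lambda_s^{\mathbb Z}\to\Lambda_s^{\mathbb Z}$ with $\tau\sigma=\sigma\tau$, and $Aut(\Lambda_s^{\mathbb Z})$ is the group of all bijective elements of $CAT(\Lambda_s^{\mathbb Z})$. For a prime $p$ dividing $s$, $\mu_p\in CAT(\Lambda_s^{\mathbb Z})$ is defined by $\mu_p(a)_k=\left(p\,a_k+\left\lfloor \frac{p\,a_{k+1}}{s}\right\rfloor\right) \bmod s$ for $k\in\mathbb Z$. $\langle \tau_1,\dots,\tau_n\rangle$ denotes the semigroup generated by $\tau_1,\dots,\tau_n$ under composition. A semigroup $\Sigma\subset CAT(\Lambda_s^{\mathbb Z})$ is ID if every closed $\Sigma$-invariant proper subset of $\Lambda_s^{\mathbb Z}$ is finite; a set $A$ is $\Sigma$-invariant if $\tau(A)\subset A$ for all $\tau\in\Sigma$. *)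

(* Defs.v *)
From mathcomp Require Import all_boot all_order all_algebra.
From mathcomp Require Import all_classical topology function_spaces.

Set Implicit Arguments.
Unset Strict Implicit.
Unset Printing Implicit Defensive.

Import GRing.Theory.

Local Open Scope classical_set_scope.
Local Open Scope ring_scope.

Definition config (s : nat) : topologicalType :=
  {ptws int -> discrete_topology 'I_s}.

Definition left_shift (s : nat) (a : config s) : config s := fun k => a (k + 1).

Definition left_shift_inv (s : nat) (a : config s) : config s :=
  fun k => a (k - 1).

Lemma left_shiftK (s : nat) : cancel (@left_shift s) (@left_shift_inv s).
Proof.
by move=> a; apply/funext => k; rewrite /left_shift /left_shift_inv subrK.
Qed.

Lemma left_shift_invK (s : nat) : cancel (@left_shift_inv s) (@left_shift s).
Proof.
by move=> a; apply/funext => k; rewrite /left_shift /left_shift_inv addrK.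
Qed.

(* The mere existence of a symbol forces the modulus [s] to be positive. *)
Lemma ord_gt0 (s : nat) (i : 'I_s) : (0 < s)%N.
Proof. exact: leq_ltn_trans (leq0n i) (ltn_ord i). Qed.

Definition mu (s p : nat) (a : config s) : config s :=
  fun k =>
    Ordinal (ltn_pmod (p * a k + (p * a (k + 1)%R) %/ s)%N (ord_gt0 (a k))).

Definition CAT (s : nat) : set (config s -> config s) :=
  [set tau | continuous tau /\ tau \o @left_shift s = @left_shift s \o tau].

Definition Aut (s : nat) : set (config s -> config s) :=
  [set tau | CAT tau /\ bijective tau].

Definition is_semigroup (T : Type) (S : set (T -> T)) : Prop :=
  forall f g, S f -> S g -> S (f \o g).

Definition generated_semigroup (T : Type) (G : set (T -> T)) : set (T -> T) :=
  smallest (@is_semigroup T) G.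

Definition invariant_under (T : Type) (S : set (T -> T)) (A : set T) : Prop :=
  forall tau, S tau -> tau @` A `<=` A.

Definition is_ID_semigroup (s : nat) (S : set (config s -> config s)) : Prop :=
  [/\ S `<=` @CAT s, is_semigroup S &
      forall A : set (config s),
        closed A -> invariant_under S A -> A <> setT -> finite_set A].

(* Main.v *)
(* Reading the coordinates a_1 a_2 ... as the base-[s] expansion of a real
   number turns [left_shift] into multiplication by [s] and [mu p] into
   multiplication by [p], up to integers. As [p] and [s] are multiplicatively
   independent, Furstenberg's x2 x3 theorem applies: the values of an infinite
   invariant set are dense modulo 1, and shift invariance turns this into
   density of the set itself.
   Furstenberg's theorem is obtained along the lines of Boshernitzan's proof.
   Let X be the set of limit points of an infinite invariant set. If X contains
   a rational point, a power of the semigroup fixes a rational point of X modulo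
   1 and blows up its neighbourhoods until they fill the circle. Otherwise, the
   difference set of any nonempty closed invariant subset of X is dense, by the
   rational case at 0, and hence everything; applied to a power of the semigroup
   fixing 1/t, this gives by induction a point x with all x + j/t in X.
   The statement on [Aut] follows because [mu (s/p)] composed with [mu p] is the
   shift, so that [mu p] is invertible. *)

Require Import Defs.
From mathcomp Require Import all_boot all_order all_algebra cyclic.
From mathcomp Require Import all_classical topology function_spaces.
From mathcomp Require Import reals Rstruct.
From mathcomp Require Import zify ring lra.

Import Order.TTheory GRing.Theory Num.Theory.

Local Open Scope classical_set_scope.

(** * Furstenberg's theorem on the real line *)

Section Furstenberg.
Set Implicit Arguments.
Unset Strict Implicit.
Unset Printing Implicit Defensive.
Local Open Scope ring_scope.

Context (R : realType).

Lemma nat_pigeonhole (m : nat) (f : nat -> 'I_m) :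
  exists i j : nat, (i < j <= m)%N /\ f i = f j.
Proof.
have /injectivePn [i [j ij fij]] : ~~ injectiveb (fun i : 'I_m.+1 => f i).
  apply/negP => /injectiveP /leq_card.
  by rewrite !card_ord ltnn.
case: (ltngtP i j) => [lt_ij|lt_ji|/val_inj eq_ij].
- by exists i, j; rewrite lt_ij leq_ord.
- by exists j, i; rewrite lt_ji leq_ord.
- by rewrite eq_ij eqxx in ij.
Qed.

Implicit Types (E X Y : set R) (x y e d r : R) (a b : nat).

Definition adherent E y := forall e, 0 < e -> exists2 x, E x & `|x - y| < e.

Definition clusters E y :=
  forall e, 0 < e -> exists2 x, E x & 0 < `|x - y| < e.

Definition int_periodic E := forall x (n : int), E x -> E (x + n%:~R).

Definition mul_invariant a E := forall x, E x -> E (a%:R * x).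

(** For [a, b >= 2] this is irrationality of log a / log b; [j = 0] follows from [i = 0]. *)
Definition mul_independent a b :=
  forall i j : nat, (a ^ i = b ^ j)%N -> i = 0%N.

(** * Products of powers of two multiplicatively independent integers *)

Lemma close_pair (f : nat -> R) B e : 0 < e -> (forall n, 0 <= f n < B) ->
  exists i j : nat, (i < j)%N /\ `|f i - f j| < e.
Proof.
move=> e0 fB.
have f0 n : 0 <= f n / e by case/andP: (fB n) => f0 _; rewrite divr_ge0 // ltW.
have fM n : (Num.truncn (f n / e)%R < (Num.truncn (B / e)%R).+1)%N.
  rewrite ltnS; apply: le_truncn; rewrite ler_pM2r ?invr_gt0 //.
  by case/andP: (fB n) => _ /ltW.
have [i [j [/andP[ij _] [eqf]]]] := nat_pigeonhole (fun n => Ordinal (fM n)).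
exists i, j; split => //.
have := truncn_itv (f0 i); rewrite eqf; have := truncn_itv (f0 j).
rewrite -natr1 ler_pdivlMr // !ltr_pdivrMr // ler_pdivlMr //.
move: (_%:R) => k.
by rewrite ltr_norml => /andP[? ?] /andP[? ?]; apply/andP; split; nra.
Qed.

(** Dividing each [a ^ n] by the largest power of [b] below it gives numbers in [1, b[. Two of them
    are closer than [d], and both are at least 1, so their quotient is within a factor [1 + d] of 1.
    Independence excludes the quotient 1; which side of 1 it falls on is unknown, hence the
    disjunction. *)
Lemma near_ratio a b d : (2 <= a)%N -> (2 <= b)%N -> mul_independent a b ->
  0 < d ->
  (exists i j : nat, (b%:R : R) ^+ j < a%:R ^+ i < (1 + d) * b%:R ^+ j) \/
  (exists i j : nat, (a%:R : R) ^+ i < b%:R ^+ j < (1 + d) * a%:R ^+ i).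
Proof.
move=> a2 b2 indep d0.
pose k n := trunc_log b (a ^ n).
have kP n : (b ^ k n <= a ^ n < b ^ (k n).+1)%N.
  by apply: trunc_log_bounds => //; rewrite expn_gt0; case: a a2 {indep k}.
have b0 m : 0 < b%:R ^+ m :> R by rewrite exprn_gt0 // ltr0n; lia.
have a0 m : 0 < a%:R ^+ m :> R by rewrite exprn_gt0 // ltr0n; lia.
have fB n : 0 <= (a%:R : R) ^+ n / b%:R ^+ k n < b%:R.
  have /andP[lo hi] := kP n.
  by rewrite ltW ?divr_gt0 //= ltr_pdivrMr // -exprS -!natrX ltr_nat.
have [i [j [ij dij]]] := close_pair d0 fB.
have kij : (k i <= k j)%N by apply: leq_trunc_log; rewrite leq_exp2l // ltnW.
have u1 : 1 <= a%:R ^+ i / b%:R ^+ k i :> R.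
  by rewrite ler_pdivlMr // mul1r -!natrX ler_nat; case/andP: (kP i).
have v1 : 1 <= a%:R ^+ j / b%:R ^+ k j :> R.
  by rewrite ler_pdivlMr // mul1r -!natrX ler_nat; case/andP: (kP j).
have uv : a%:R ^+ j / b%:R ^+ k j =
  (a%:R ^+ i / b%:R ^+ k i) * (a%:R ^+ (j - i) / b%:R ^+ (k j - k i)) :> R.
  rewrite -{1}(subnKC (ltnW ij)) -{1}(subnKC kij) !exprD.
  by rewrite invfM mulrACA.
move: dij u1 v1; rewrite uv; move: (a%:R ^+ i / _) => u.
set v := (_ / b%:R ^+ (k j - k i)) => dij u1 v1.
case: (ltrgtP 1 v) => [gt1|lt1|eq1].
- left; exists (j - i)%N, (k j - k i)%N.
  rewrite -ltr_pdivrMr // -/v -[X in X < _]mul1r -ltr_pdivlMr // gt1 /=.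
  by move: dij; rewrite ltr_norml => /andP[]; nra.
- right; exists (j - i)%N, (k j - k i)%N.
  have : v < 1 by [].
  rewrite /v ltr_pdivrMr // mul1r => -> /=.
  suff : 1 < (1 + d) * v by rewrite /v mulrA ltr_pdivlMr // mul1r.
  by move: dij; rewrite ltr_norml => /andP[]; nra.
- have /esym/eqP := eq1.
  rewrite /v -(inj_eq (mulIf (lt0r_neq0 (b0 (k j - k i)%N)))).
  rewrite divfK ?lt0r_neq0 // mul1r -!natrX eqr_nat => /eqP /indep.
  by move/eqP; rewrite subn_eq0 leqNgt ij.
Qed.

Lemma bernoulli (x : R) (n : nat) : 0 <= x -> 1 + n%:R * x <= (1 + x) ^+ n.
Proof.
move=> x0; elim: n => [|n IH]; first by rewrite expr0 mul0r addr0.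
rewrite exprS -natr1; have := ler0n R n; move: (n%:R : R) IH => N IH N0.
by apply: le_trans (ler_wpM2l _ IH); nra.
Qed.

(** Start from the power [b ^ m] just below [T] and multiply by [r = a ^ i / b ^ j], which lies
    between 1 and [1 + d], until [T] is reached: the last step overshoots by a factor below
    [1 + d]. *)
Lemma ratio_fills a b d i j : (2 <= b)%N -> 0 < d ->
  (b%:R : R) ^+ j < a%:R ^+ i < (1 + d) * b%:R ^+ j ->
  exists K : R, forall T, K <= T ->
    exists k l : nat, T <= a%:R ^+ k * b%:R ^+ l < (1 + d) * T.
Proof.
move=> b2 d0 /andP[r1 r2].
have b0 m : 0 < b%:R ^+ m :> R by rewrite exprn_gt0 // ltr0n; lia.
pose r : R := a%:R ^+ i / b%:R ^+ j.
have {}r1 : 1 < r by rewrite ltr_pdivlMr // mul1r.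
have {}r2 : r < 1 + d by rewrite ltr_pdivrMr.
(* By Bernoulli, [N] factors [r] suffice to pass from [b ^ m] to [b ^ m.+1]. *)
pose N := (Num.truncn (b%:R / (r - 1))%R).+1.
have rN : b%:R <= r ^+ N.
  have := @bernoulli (r - 1) N.
  rewrite subr_ge0 [1 + (_ - _)]addrC subrK => /(_ (ltW r1)).
  apply: le_trans; rewrite ler_wpDl // -ler_pdivrMr ?subr_gt0 //.
  have h : 0 <= b%:R / (r - 1) by rewrite divr_ge0 ?ler0n // subr_ge0 ltW.
  by case/andP: (truncn_itv h) => _ /ltW.
(* Above this bound [m >= j * N], so [b ^ m] absorbs the denominators of up to [N] factors [r]. *)
exists (b%:R ^+ (j * N)) => T KT.
have T0 : 0 < T by exact: lt_le_trans KT.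
have [m [jNm mT Tm]] : exists m : nat,
    [/\ (j * N <= m)%N, b%:R ^+ m <= T & T < b%:R ^+ m.+1].
  have /andP[t1 t2] := truncn_itv (ltW T0).
  have tK : (b ^ (j * N) <= Num.truncn T)%N.
    by rewrite (truncn_ge_nat _ (ltW T0)) natrX.
  have t0 : (0 < Num.truncn T)%N by apply: leq_trans tK; rewrite expn_gt0; lia.
  have /andP[m1 m2] := trunc_log_bounds b2 t0.
  exists (trunc_log b (Num.truncn T)); split.
  - by rewrite -ltnS -(ltn_exp2l _ _ b2); apply: leq_ltn_trans tK m2.
  - by apply: le_trans t1; rewrite -natrX ler_nat.
  - by apply: lt_le_trans t2 _; rewrite -natrX ler_nat.
pose u l : R := b%:R ^+ m * r ^+ l.
have uN : T <= u N.
  apply: (le_trans (ltW Tm)); rewrite exprS mulrC /u.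
  by rewrite ler_wpM2l // ltW.
have [l [lN Tl lT]] : exists l, [/\ (l <= N)%N, T <= u l & u l < (1 + d) * T].
  have exl : exists l, T <= u l by exists N.
  case: (ex_minnP exl) => l Tl lmin; exists l; split=> //; first exact: lmin.
  case: l Tl lmin => [|l] Tl lmin.
    by rewrite /u expr0 mulr1; apply: le_lt_trans mT _; nra.
  have ul : u l < T by rewrite ltNge; apply/negP => /lmin; rewrite ltnn.
  have -> : u l.+1 = r * u l by rewrite /u exprS mulrCA.
  by apply: lt_trans (_ : r * T < _); rewrite ?ltr_pM2l ?ltr_pM2r //; lra.
have jlm : (j * l <= m)%N by apply: leq_trans jNm; rewrite leq_mul2l lN orbT.
exists (i * l)%N, (m - j * l)%N.
suff -> : a%:R ^+ (i * l) * b%:R ^+ (m - j * l) = u l by rewrite Tl.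
rewrite /u -{2}(subnKC jlm) exprD /r expr_div_n -!exprM.
by field; rewrite lt0r_neq0.
Qed.

Lemma fills a b d : (2 <= a)%N -> (2 <= b)%N -> mul_independent a b -> 0 < d ->
  exists K : R, forall T, K <= T ->
    exists k l : nat, T <= a%:R ^+ k * b%:R ^+ l < (1 + d) * T.
Proof.
move=> a2 b2 indep d0; case: (near_ratio a2 b2 indep d0) => -[i [j ij]].
  exact: ratio_fills b2 d0 ij.
have [K HK] := ratio_fills a2 d0 ij.
by exists K => T /HK [k [l kl]]; exists l, k; rewrite mulrC.
Qed.

(** * Density from accumulation at 0 *)

Lemma int_window y (m : int) : exists n : int, m%:~R <= y - n%:~R < m%:~R + 1.
Proof.
exists (Num.floor y - m).
have := floor_itv y; rewrite !rmorphD rmorphN /=; move: (_%:~R) => z; lra.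
Qed.

Lemma mul_invariantX a E k x : mul_invariant a E -> E x -> E (a%:R ^+ k * x).
Proof.
move=> inva; elim: k => [|k IH] Ex; first by rewrite expr0 mul1r.
by rewrite exprS -mulrA; apply/inva/IH.
Qed.

(** For [x] in [E] close enough to 0, the multiples [a ^ k * b ^ l * x] come, in absolute value,
    within [e] of every point of [1, 2[, by [fills] at [T = z / |x|]. An integer translation brings
    [y], or [- y] if [x < 0], into this window. *)
Lemma dense_of_small a b E : (2 <= a)%N -> (2 <= b)%N -> mul_independent a b ->
  int_periodic E -> mul_invariant a E -> mul_invariant b E ->
  clusters E 0 -> forall y, adherent E y.
Proof.
move=> a2 b2 indep perE inva invb E0 y e e0.
(* As [z < 2], the relative error [e / 2] is an absolute error below [e]. *)
have d0 : 0 < e / 2 by lra.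
have [K HK] := fills a2 b2 indep d0.
have K0 : 0 < Num.max 1 K by rewrite lt_max ltr01.
have [x Ex] := E0 _ (divr_gt0 ltr01 K0).
rewrite subr0 => /andP[x0 xK].
have bigT z : 1 <= z -> K <= z / `|x|.
  move=> z1; rewrite ler_pdivlMr //; apply: le_trans z1.
  move: xK; rewrite ltr_pdivlMr // => /ltW; apply: le_trans.
  by rewrite [K * _]mulrC ler_wpM2l // le_max lexx orbT.
have hits z : 1 <= z < 2 -> exists k l : nat,
    z <= a%:R ^+ k * b%:R ^+ l * `|x| < z + e.
  move=> /andP[z1 z2]; have [k [l /andP[kl1 kl2]]] := HK _ (bigT _ z1).
  exists k, l; rewrite -ler_pdivrMr // kl1 /=.
  have : a%:R ^+ k * b%:R ^+ l * `|x| < (1 + e / 2) * z.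
    by rewrite -ltr_pdivlMr // -mulrA.
  nra.
have Ekl k l : E (a%:R ^+ k * b%:R ^+ l * x).
  by rewrite -mulrA; do 2 apply: mul_invariantX => //.
have : x != 0 by rewrite -normr_gt0.
case: (ltrgtP x 0) => // xs _.
- have [n /andP[n1 n2]] := int_window (- y) 1.
  have [|k [l]] := hits (- y - n%:~R); first lra.
  rewrite ltr0_norm // => kl; exists (a%:R ^+ k * b%:R ^+ l * x + (- n)%:~R).
    exact: perE.
  rewrite rmorphN /= ltr_norml; move: kl; rewrite mulrN.
  by move: (_ * x) (n%:~R) => u N; lra.
- have [n /andP[n1 n2]] := int_window y 1.
  have [|k [l]] := hits (y - n%:~R); first lra.
  rewrite gtr0_norm // => kl; exists (a%:R ^+ k * b%:R ^+ l * x + n%:~R).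
    exact: perE.
  rewrite ltr_norml; move: kl.
  by move: (_ * x) (n%:~R) => u N; lra.
Qed.

(* Bolzano-Weierstrass, for nonempty subsets of [0, 1[ shrinking with [e]. *)
Lemma cluster_point (P : R -> R -> Prop) :
  (forall e e' y, e <= e' -> P e y -> P e' y) ->
  (forall e, 0 < e -> exists2 y, 0 <= y < 1 & P e y) ->
  exists y, forall e, 0 < e -> exists2 z, `|z - y| < e & P e z.
Proof.
move=> Pmono Pex.
(* [sup S] is the largest limit, as [e] tends to 0, of points of [0, 1[ satisfying [P e]. *)
pose S := [set z | forall e, 0 < e -> exists2 y, z <= y < 1 & P e y].
have supS : has_sup S.
  split; first by exists 0.
  exists 1 => z /(_ 1 ltr01) [y /andP[zy y1] _].
  by rewrite ltW // (le_lt_trans zy).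
exists (sup S) => e e0.
have [z Sz ez] := sup_adherent e0 supS.
have [e' [e'0 noe']] : exists e', 0 < e' /\
    forall y, sup S + e <= y < 1 -> ~ P e' y.
  have : ~ S (sup S + e).
    by move=> /(ub_le_sup supS.2); rewrite gerDl leNgt e0.
  move=> /existsNP[e' /not_implyP[e'0 He']]; exists e'; split=> // y ySe Py.
  by apply: He'; exists y.
have m0 : 0 < Num.min e e' by rewrite lt_min e0.
have [y /andP[zy y1] Py] := Sz _ m0; exists y.
  rewrite ltr_norml; apply/andP; split; first lra.
  rewrite ltrBlDl ltNge; apply/negP => ySe.
  apply: (noe' y); first by rewrite ySe.
  by apply: Pmono Py; rewrite ge_min lexx orbT.
by apply: Pmono Py; rewrite ge_min lexx.
Qed.

(** * Sets of limit points *)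

Lemma clusters_adherent E y : clusters E y -> adherent E y.
Proof. by move=> Ey e /Ey [x Ex /andP[_ ?]]; exists x. Qed.

Lemma clusters_closed E y : adherent (clusters E) y -> clusters E y.
Proof.
move=> Ey e e0; have e20 : 0 < e / 2 by lra.
have [x Ex xy] := Ey _ e20.
have [->|nxy] := eqVneq y x; first exact: Ex.
have m0 : 0 < Num.min (e / 2) `|x - y|.
  by rewrite lt_min e20 normr_gt0 subr_eq0 eq_sym.
have [z Ez /andP[z0]] := Ex _ m0; rewrite lt_min => /andP[z1 z2].
exists z => //; have -> : z - y = (z - x) + (x - y) by ring.
apply/andP; split; last by apply: le_lt_trans (ler_normD _ _) _; lra.
have := lerB_normD (x - y) (z - x); rewrite [z - x + _]addrC; lra.
Qed.

Lemma clusters_int_periodic E :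
  int_periodic E -> int_periodic (clusters E).
Proof.
move=> perE x n Ex e /Ex [z Ez zx]; exists (z + n%:~R); first exact: perE.
by rewrite opprD addrACA subrr addr0.
Qed.

Lemma clusters_mul_invariant a E : (0 < a)%N ->
  mul_invariant a E -> mul_invariant a (clusters E).
Proof.
move=> a0 inva x Ex e e0; have a0' : 0 < a%:R :> R by rewrite ltr0n.
have [z Ez /andP[z1 z2]] := Ex _ (divr_gt0 e0 a0').
exists (a%:R * z); first exact: inva.
by rewrite -mulrBr normrM normr_nat mulr_gt0 //= mulrC -ltr_pdivlMr.
Qed.

(** * Rational and irrational limit points *)

Lemma totient_power a t : (0 < a)%N -> coprime a t ->
  exists q, (a ^ totient t = 1 + q * t)%N.
Proof.
move=> a0 at1; have /eqP := Euler_exp_totient at1.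
rewrite eqn_mod_dvd ?expn_gt0 ?a0 // => /dvdnP[q qE]; exists q.
by rewrite -qE subnKC // expn_gt0 a0.
Qed.

Lemma mul_independentX a b k : (0 < k)%N ->
  mul_independent a b -> mul_independent (a ^ k) (b ^ k).
Proof.
move=> k0 indep i j; rewrite -!expnM => /indep /eqP.
by rewrite muln_eq0 eqn0Ngt k0 => /eqP.
Qed.

Lemma leq2_expn a k : (2 <= a)%N -> (0 < k)%N -> (2 <= a ^ k)%N.
Proof. by move=> a2 k0; apply: leq_trans (leq_pexp2l (ltnW a2) k0). Qed.

(** With [k = totient t], Euler's theorem makes [a ^ k] and [b ^ k] congruent to 1 modulo [t], so
    multiplication by them fixes [r] modulo 1. Translating [r] to 0 reduces the claim to
    [dense_of_small]. *)
Lemma dense_of_rational_cluster a b E r t :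
  (2 <= a)%N -> (2 <= b)%N -> mul_independent a b ->
  int_periodic E -> mul_invariant a E -> mul_invariant b E ->
  (0 < t)%N -> coprime a t -> coprime b t -> t%:R * r \is a Num.int ->
  clusters E r -> forall y, adherent E y.
Proof.
move=> a2 b2 indep perE inva invb t0 cat cbt /intrP[m trm] Er y e e0.
pose k := totient t.
have k0 : (0 < k)%N by rewrite totient_gt0.
pose E' := [set x | E (x + r)].
have invE' c : (2 <= c)%N -> coprime c t -> mul_invariant c E ->
    mul_invariant (c ^ k) E'.
  move=> /ltnW c0 /(totient_power c0)[q cq] invc x E'x; rewrite /E' /=.
  have -> : (c ^ k)%:R * x + r = c%:R ^+ k * (x + r) + (- (q%:Z * m))%:~R.
    rewrite rmorphN rmorphM /= -trm -natrX cq natrD natrM; ring.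
  by apply: perE; apply: mul_invariantX.
have perE' : int_periodic E'.
  by move=> x n E'x; rewrite /E' /= addrAC; apply: perE.
have E'0 : clusters E' 0.
  move=> d /Er [x Ex xr]; exists (x - r); last by rewrite subr0.
  by rewrite /E' /= subrK.
have [x E'x xy] := dense_of_small (leq2_expn a2 k0) (leq2_expn b2 k0)
  (mul_independentX k0 indep) perE' (invE' _ a2 cat inva)
  (invE' _ b2 cbt invb) E'0
  (y - r) e0.
by exists (x + r) => //; move: xy; rewrite opprB addrA.
Qed.

(** The powers of [c] are eventually periodic modulo [t]. The new denominator [c ^ k - 1] is coprime
    to [c], as [dense_of_rational_cluster] requires. *)
Lemma rational_orbit (c : nat) r t :
  (2 <= c)%N -> (0 < t)%N -> t%:R * r \is a Num.int ->
  exists i k, (0 < k)%N /\ (c ^ k - 1)%:R * (c%:R ^+ i * r) \is a Num.int.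
Proof.
move=> c2 t0 tr.
have [i [j [/andP[ij _]]]] :=
  nat_pigeonhole (fun n => Ordinal (ltn_pmod (c ^ n)%N t0)).
have leij : (c ^ i <= c ^ j)%N by rewrite leq_exp2l // ltnW.
move=> /(congr1 val) /esym /= /eqP.
rewrite (eqn_mod_dvd _ leij) => /dvdnP[q qE].
exists i, (j - i)%N; rewrite subn_gt0; split => //.
rewrite mulrA -natrX -natrM mulnBl mul1n -expnD subnK 1?ltnW // qE natrM -mulrA.
by rewrite rpredM // natr_int.
Qed.

(** The fractional parts of [a ^ n * x0] are pairwise distinct, so two of them are arbitrarily close
    and the difference set [D] of [Y] accumulates at 0. Hence [D] is dense, and compactness of [Y]
    modulo 1 makes [d] itself a difference. *)
Lemma irrational_translate a b Y x0 :
  (2 <= a)%N -> (2 <= b)%N -> mul_independent a b ->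
  (forall y, adherent Y y -> Y y) ->
  int_periodic Y -> mul_invariant a Y -> mul_invariant b Y ->
  Y x0 -> (forall n, (0 < n)%N -> n%:R * x0 \isn't a Num.int) ->
  forall d, exists2 y, Y y & Y (y + d).
Proof.
move=> a2 b2 indep clY perY inva invb Yx0 irr d.
pose D := [set z | exists x y, [/\ Y x, Y y & z = x - y]].
have D0 : clusters D 0.
  move=> e e0.
  pose fl n : int := Num.floor (a%:R ^+ n * x0).
  have fB n : 0 <= a%:R ^+ n * x0 - (fl n)%:~R < 1.
    have /andP[] := floor_itv (a%:R ^+ n * x0); rewrite intrD -/(fl n).
    by move=> f1 f2; rewrite subr_ge0 f1 ltrBlDl.
  have Yf n : Y (a%:R ^+ n * x0 - (fl n)%:~R).
    by rewrite -mulrNz; apply: perY; apply: mul_invariantX.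
  have [i [j [ij dij]]] := close_pair e0 fB.
  exists ((a%:R ^+ i * x0 - (fl i)%:~R) - (a%:R ^+ j * x0 - (fl j)%:~R)).
    by exists (a%:R ^+ i * x0 - (fl i)%:~R), (a%:R ^+ j * x0 - (fl j)%:~R).
  (* Equal fractional parts would make [(a ^ j - a ^ i) * x0] an integer. *)
  rewrite subr0 dij andbT normr_gt0; apply/eqP => fij.
  have ltaij : (a ^ i < a ^ j)%N by rewrite ltn_exp2l.
  have /irr /negP : (0 < a ^ j - a ^ i)%N by rewrite subn_gt0.
  apply.
  rewrite natrB 1?ltnW // !natrX mulrBl.
  have -> : a%:R ^+ j * x0 - a%:R ^+ i * x0 = (fl j - fl i)%:~R.
    by rewrite intrB; lra.
  exact: intr_int.
have perD : int_periodic D.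
  move=> z n [x [y [Yx Yy ->]]]; exists (x + n%:~R), y.
  by split => //; [apply: perY | ring].
have invD c : mul_invariant c Y -> mul_invariant c D.
  move=> invc z [x [y [Yx Yy ->]]]; exists (c%:R * x), (c%:R * y).
  by split; [apply: invc | apply: invc | ring].
have denseD := dense_of_small a2 b2 indep perD (invD _ inva) (invD _ invb) D0.
pose P e y := Y y /\ exists2 x, Y x & `|x - y - d| < e.
have [||y Hy] := @cluster_point P.
- move=> e e' y ee' [Yy [x Yx xy]]; split=> //.
  by exists x => //; apply: lt_le_trans ee'.
- move=> e e0; have [_ [x [y [Yx Yy ->]]] xyd] := denseD d e e0.
  have [n] := int_window y 0; rewrite add0r => yn.
  exists (y - n%:~R) => //; split; first by rewrite -mulrNz; apply: perY.
  exists (x - n%:~R); first by rewrite -mulrNz; apply: perY.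
  by congr (`|_| < _): xyd; ring.
exists y; apply: clY => e e0.
  by have [z zy [Yz _]] := Hy e e0; exists z.
have e20 : 0 < e / 2 by lra.
have [z zy [Yz [x Yx xzd]]] := Hy _ e20; exists x => //.
have -> : x - (y + d) = (x - z - d) + (z - y) by ring.
by apply: le_lt_trans (ler_normD _ _) _; lra.
Qed.

(** For [t] coprime to [a] and [b], suitable powers of both fix [1 / t] modulo 1 and so preserve the
    set [Y i] of starting points of progressions of step [1 / t] and [i + 1] terms in [X]. Applying
    [irrational_translate] to [Y i] with [d = 1 / t] lengthens the progression by one term; a
    progression from [Y t] goes once round the circle. *)
Lemma irrational_dense a b X x0 :
  (2 <= a)%N -> (2 <= b)%N -> mul_independent a b ->
  (forall y, adherent X y -> X y) ->
  int_periodic X -> mul_invariant a X -> mul_invariant b X ->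
  X x0 -> (forall x n, X x -> (0 < n)%N -> n%:R * x \isn't a Num.int) ->
  forall y, adherent X y.
Proof.
move=> a2 b2 indep clX perX inva invb Xx0 irr y e e0.
(* This [t] is 1 modulo [a] and modulo [b], and exceeds [1 / e]. *)
pose t := (a * b * (Num.truncn e^-1).+1).+1.
have t0 : 0 < t%:R :> R by rewrite ltr0n.
have te : t%:R^-1 < e.
  rewrite invf_plt ?posrE //.
  have e'0 : 0 <= e^-1 by rewrite invr_ge0 ltW.
  have /andP[_ /lt_le_trans] := truncn_itv e'0; apply.
  by rewrite ler_nat /t; nia.
have coprime_t c n : coprime c (c * n).+1.
  by rewrite -addn1 -coprime_modr mulnC modnMDl coprime_modr coprimen1.
have cat : coprime a t by rewrite /t -mulnA.
have cbt : coprime b t by rewrite /t [(a * b)%N]mulnC -mulnA.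
pose k := totient t.
have k0 : (0 < k)%N by rewrite totient_gt0.
pose Y i := [set x | forall j, (j <= i)%N -> X (x + j%:R / t%:R)].
have invY c i : (2 <= c)%N -> coprime c t -> mul_invariant c X ->
    mul_invariant (c ^ k) (Y i).
  move=> /ltnW c0 /(totient_power c0)[q cq] invc x Yx j ji.
  have -> : (c ^ k)%:R * x + j%:R / t%:R =
      c%:R ^+ k * (x + j%:R / t%:R) + (- (q * j)%N%:Z)%:~R.
    rewrite -natrX cq natrD !natrM rmorphN /= -pmulrn natrM; field.
    exact: lt0r_neq0.
  by apply: perX; apply: mul_invariantX => //; apply: Yx.
have perY i : int_periodic (Y i).
  by move=> x n Yx j ji; rewrite addrAC; apply/perX/Yx.
have clY i z : adherent (Y i) z -> Y i z.
  move=> Yz j ji; apply: clX => d /Yz [x Yx xz]; exists (x + j%:R / t%:R).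
    exact: Yx.
  by rewrite opprD addrACA subrr addr0.
have exY i : exists x, Y i x.
  elim: i => [|i [x Yx]].
    by exists x0 => j; rewrite leqn0 => /eqP ->; rewrite mul0r addr0.
  have irrx n : (0 < n)%N -> n%:R * x \isn't a Num.int.
    by apply: irr; have := Yx 0%N (leq0n _); rewrite mul0r addr0.
  have [z Yz Yz1] := irrational_translate (leq2_expn a2 k0) (leq2_expn b2 k0)
    (mul_independentX k0 indep) (@clY i) (@perY i) (invY _ i a2 cat inva)
    (invY _ i b2 cbt invb) Yx irrx t%:R^-1.
  exists z => -[|j] ji; first exact: Yz.
  by have := Yz1 j ji; rewrite -addrA -natr1 mulrDl mul1r [t%:R^-1 + _]addrC.
have [x Yx] := exY t.
have [n] := int_window (y - x) 0; rewrite add0r; set z := _ - _ => /andP[z0 z1].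
have tz0 : 0 <= t%:R * z by rewrite mulr_ge0 // ltW.
have /andP[j1 j2] := truncn_itv tz0.
move: (Num.truncn _) j1 j2 => j j1 j2.
have jt : (j <= t)%N.
  by rewrite -(ler_nat R); apply: le_trans j1 _; rewrite ger_pMr // ltW.
exists (x + j%:R / t%:R + n%:~R); first by apply/perX/Yx.
have -> : x + j%:R / t%:R + n%:~R - y = j%:R / t%:R - z by rewrite /z; ring.
apply: le_lt_trans te; rewrite ler_norml.
have jz : j%:R / t%:R <= z by rewrite ler_pdivrMr // mulrC.
have : z < j.+1%:R / t%:R by rewrite ltr_pdivlMr // mulrC.
have t'0 : 0 < t%:R^-1 :> R by rewrite invr_gt0.
by rewrite -natr1 mulrDl mul1r => zj; apply/andP; split; lra.
Qed.

(** Arbitrarily close pairs of distinct points express that [E] is infinite modulo 1. They yield a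
    limit point; the proof then splits on whether some limit point is rational. *)
Theorem furstenberg a b E : (2 <= a)%N -> (2 <= b)%N -> mul_independent a b ->
  int_periodic E -> mul_invariant a E -> mul_invariant b E ->
  (forall e, 0 < e -> exists x y, [/\ E x, E y & 0 < `|x - y| < e]) ->
  forall y, adherent E y.
Proof.
move=> a2 b2 indep perE inva invb closeE y.
set X := clusters E.
have [x0 Xx0] : exists x, X x.
  pose P e y := E y /\ exists2 x, E x & 0 < `|x - y| < e.
  have [||z Hz] := @cluster_point P.
  - move=> e e' z ee' [Ez [x Ex /andP[x0 xe]]]; split=> //; exists x => //.
    by rewrite x0 (lt_le_trans xe).
  - move=> e /closeE [u [v [Eu Ev uv]]].
    have [n] := int_window v 0; rewrite add0r => vn.
    exists (v - n%:~R) => //; split; first by rewrite -mulrNz; apply: perE.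
    exists (u - n%:~R); first by rewrite -mulrNz; apply: perE.
    by rewrite opprB addrA subrK.
  exists z => e e0; have [v vz [Ev [u Eu uv]]] := Hz e e0.
  (* Of the two distinct points [u] and [v], one differs from [z]. *)
  have [vz0|vz0] := eqVneq v z; first by exists u => //; rewrite -vz0.
  by exists v => //; rewrite vz normr_gt0 subr_eq0 vz0.
have perX : int_periodic X by apply: clusters_int_periodic.
have invXa : mul_invariant a X := clusters_mul_invariant (ltnW a2) inva.
have invXb : mul_invariant b X := clusters_mul_invariant (ltnW b2) invb.
have [[r [t [Xr t0 tr]]]|irr] :=
    pselect (exists r t, [/\ X r, (0 < t)%N & t%:R * r \is a Num.int]).
  (* Working with the product makes the denominator [c ^ k - 1] coprime to [a] and [b] at once. *)
  pose c := (a * b)%N.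
  have c2 : (2 <= c)%N by rewrite /c; nia.
  have [i [k [k0 kr]]] := rational_orbit c2 t0 tr.
  have ck2 := leq2_expn c2 k0.
  have coprime_c : coprime c (c ^ k - 1).
    by rewrite -(coprime_pexpl _ _ k0) subn1 coprimenP // ltnW.
  apply: (dense_of_rational_cluster a2 b2 indep perE inva invb _ _ _ kr).
  - by rewrite subn_gt0.
  - by apply: coprime_dvdl coprime_c; apply: dvdn_mulr.
  - by apply: coprime_dvdl coprime_c; apply: dvdn_mull.
  - have invXc : mul_invariant c X.
      by move=> x Xx; rewrite natrM -mulrA; apply/invXa/invXb.
    exact: (mul_invariantX i invXc Xr).
have Xy := irrational_dense a2 b2 indep (@clusters_closed E) perX invXa invXb
  Xx0.
apply/clusters_adherent/clusters_closed/Xy => x n Xx n0.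
by apply/negP => nx; apply: irr; exists x, n.
Qed.

End Furstenberg.

(** * Base-s expansions *)

Section Expansions.
Set Implicit Arguments.
Unset Strict Implicit.
Unset Printing Implicit Defensive.

(** The carry [a (k + 1) %/ q] is below [p], so adding it to a multiple of [p] below [s] never
    reaches [s], and the outer reduction has no effect. *)
Lemma mu_digit s p q (a : config s) (k : int) : (0 < p)%N -> s = (p * q)%N ->
  mu p a k = (p * (a k %% q) + a (k + 1)%R %/ q)%N :> nat.
Proof.
move=> p0 sE; have q0 : (0 < q)%N by have := ord_gt0 (a k); rewrite sE; nia.
have cp : (a (k + 1)%R %/ q < p)%N by rewrite ltn_divLR // -sE.
rewrite /mu /= [X in (_ * _ + _ %/ X)%N]sE divnMl // -modnDml.
rewrite [X in (_ * _ %% X)%N]sE -muln_modr modn_small //.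
by rewrite [X in (_ < X)%N]sE; have := ltn_pmod (a k) q0; nia.
Qed.

(** The integer with base-[s] digits [a 1 ... a L], most significant first. *)
Fixpoint word s (a : config s) (L : nat) : nat :=
  if L is L'.+1 then s * word a L' + a L else 0.

Lemma wordS s (a : config s) (L : nat) :
  word a L.+1 = (s * word a L + a L.+1)%N.
Proof. by []. Qed.

Lemma word_digits s (a b : config s) (L : nat) : word a L = word b L ->
  forall k : nat, (0 < k <= L)%N -> a k = b k.
Proof.
elim: L => [|L IH] /= eqw k; first by case: k.
have s0 := ord_gt0 (a 0%R).
have eqL : a L.+1 = b L.+1.
  apply: val_inj; have := congr1 (modn^~ s) eqw.
  by rewrite ![(s * _)%N]mulnC !modnMDl !modn_small.
move=> /andP[k0]; rewrite leq_eqVlt => /predU1P[->//|kL].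
apply: IH; last by rewrite k0 -ltnS.
move: eqw; rewrite eqL => /addIn /eqP; rewrite eqn_pmul2l // => /eqP.
exact.
Qed.

(** The [m] appended digits form an integer below [s ^ m]. *)
Lemma word_bounds s (a : config s) (L m : nat) :
  (word a L * s ^ m <= word a (L + m) < (word a L).+1 * s ^ m)%N.
Proof.
elim: m => [|m /andP[lo hi]]; first by rewrite addn0 !muln1 leqnn ltnSn.
rewrite addnS /= expnS; have := ltn_ord (a (L + m).+1).
move: (nat_of_ord _) => d ds; apply/andP; split; nia.
Qed.

Lemma word_left_shift s (a : config s) (L : nat) :
  word a L.+1 = (a 1%R * s ^ L + word (left_shift a) L)%N.
Proof.
elim: L => [|L IH]; first by rewrite /= muln0 muln1 addn0.
rewrite wordS IH [word (left_shift a) L.+1]wordS.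
have -> : left_shift a L.+1 = a L.+2.
  by rewrite /left_shift; congr (a _); rewrite -[LHS]/(Posz (L.+1 + 1)%N) addn1.
by rewrite expnS; ring.
Qed.

(* Both sides are [p] times the integer with digits [a 1 ... a L], up to the
   carry entering at position [L.+1]. *)
Lemma word_mu s p q (a : config s) (L : nat) : (0 < p)%N -> s = (p * q)%N ->
  (p * word a L + a L.+1 %/ q = a 1%R %/ q * s ^ L + word (mu p a) L)%N.
Proof.
move=> p0 sE; elim: L => [|L IH]; first by rewrite /= muln0 muln1 addn0.
have dE := divn_eq (a L.+1) q.
rewrite !wordS (mu_digit _ _ p0 sE).
have -> : (Posz L.+1 + 1 = L.+2)%R by rewrite -[LHS]/(Posz (L.+1 + 1)%N) addn1.
rewrite expnS mulnDr {1}dE.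
set W := word a L in IH *; set W' := word (mu p a) L in IH *.
set c := (_ %/ q)%N in IH *; set r := (_ %% q)%N.
have -> : (a 1%R %/ q * (s * s ^ L) + (s * W' + (p * r + a L.+2 %/ q)) =
  s * (a 1%R %/ q * s ^ L + W') + (p * r + a L.+2 %/ q))%N by ring.
rewrite -IH [X in _ = (X * (p * W + c) + _)%N]sE [X in (_ * (X * W) + _)%N]sE.
by ring.
Qed.

(** * The real number with given digits *)

Section Value.
Context (R : realType) (s : nat) (s2 : (2 <= s)%N).
Implicit Types a b : config s.
Local Open Scope ring_scope.

Definition pvalue a (L : nat) : R := (word a L)%:R / s%:R ^+ L.

(** The number with expansion 0.a_1 a_2 ... in base [s]; it equals 1 when all these digits are
    [s - 1]. *)
Definition value a : R := sup [set pvalue a L | L in [set: nat]].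

Let sX_gt0 (L : nat) : 0 < s%:R ^+ L :> R.
Proof. by rewrite exprn_gt0 // ltr0n ltnW. Qed.

Lemma pvalue_bounds a (L L' : nat) : pvalue a L' <= pvalue a L + (s%:R ^+ L)^-1.
Proof.
rewrite /pvalue -[X in _ <= _ + X]mul1r -mulrDl natr1 ler_pdivrMr // mulrAC.
rewrite ler_pdivlMr // -!natrX -!natrM ler_nat.
have [LL'|L'L] := leqP L L'.
  have /andP[_ /ltnW] := word_bounds a L (L' - L); rewrite subnKC // => h.
  rewrite -[in (s ^ L')%N](subnKC LL') expnD; nia.
have /andP[] := word_bounds a L' (L - L').
rewrite (subnKC (ltnW L'L)) => h _.
rewrite -[in (s ^ L)%N](subnKC (ltnW L'L)) expnD; nia.
Qed.

Lemma value_bounds a L : pvalue a L <= value a <= pvalue a L + (s%:R ^+ L)^-1.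
Proof.
have ubS : ubound [set pvalue a L | L in [set: nat]]
    (pvalue a L + (s%:R ^+ L)^-1).
  by move=> _ [L' _ <-]; apply: pvalue_bounds.
apply/andP; split.
  by apply: ub_le_sup; [exists (pvalue a L + (s%:R ^+ L)^-1) | exists L].
by apply: ge_sup => //; exists (pvalue a L); exists L.
Qed.

Lemma small_pow (e : R) : 0 < e -> exists L : nat, ((s%:R : R) ^+ L)^-1 < e.
Proof.
move=> e0; pose L := (Num.truncn e^-1).+1; exists L.
have e'0 : 0 <= e^-1 by rewrite invr_ge0 ltW.
have /andP[_ eL] := truncn_itv e'0.
rewrite invf_plt ?posrE //; apply: lt_trans eL _.
by rewrite -natrX ltr_nat; apply: ltn_expl.
Qed.

Lemma value_unique a (x C : R) :
  (forall L : nat, `|x - pvalue a L| <= C * (s%:R ^+ L)^-1) -> x = value a.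
Proof.
move=> xC; apply/eqP; rewrite -subr_eq0 -normr_eq0; apply/eqP.
apply/le_anti; rewrite normr_ge0 andbT leNgt; apply/negP => d0.
have C1 : 0 < `|C| + 1 by rewrite ltr_wpDl.
have [L] := small_pow (divr_gt0 d0 C1); rewrite ltr_pdivlMr // => sL.
have := value_bounds a L; have := xC L; have := ler_norm C.
have := sX_gt0 L; rewrite -invr_gt0.
suff : `|x - value a| <= `|x - pvalue a L| + `|pvalue a L - value a|.
  move: sL; move: (_^-1) => S sL h S0 hC hx /andP[v1 v2].
  have : `|pvalue a L - value a| <= S.
    by rewrite ler_norml; apply/andP; split; lra.
  nra.
have := ler_normD (x - pvalue a L) (pvalue a L - value a).
by rewrite addrA subrK.
Qed.

Lemma value_left_shift a : value (left_shift a) = s%:R * value a - (a 1)%:R.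
Proof.
have s0 : s%:R != 0 :> R by rewrite pnatr_eq0 -lt0n ltnW.
apply/esym/(@value_unique _ _ 1) => L; rewrite mul1r.
have -> : s%:R * value a - (a 1)%:R - pvalue (left_shift a) L =
    s%:R * (value a - pvalue a L.+1).
  rewrite {2}/pvalue word_left_shift natrD natrM natrX exprS /pvalue.
  by field; rewrite s0 lt0r_neq0.
have /andP[v1 v2] := value_bounds a L.+1.
rewrite ger0_norm; last by rewrite mulr_ge0 // subr_ge0.
have -> : (s%:R ^+ L)^-1 = s%:R * (s%:R ^+ L.+1)^-1 :> R.
  by rewrite exprS invfM mulVKf.
by rewrite ler_wpM2l // lerBlDl.
Qed.

Lemma value_mu p q a : (0 < p)%N -> s = (p * q)%N ->
  value (mu p a) = p%:R * value a - (a 1 %/ q)%N%:R.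
Proof.
(* Truncation after [L] digits and the carry entering at [L.+1] each contribute an error of at most
   [p / s ^ L]. *)
move=> p0 sE; apply/esym/(@value_unique _ _ (2 * p%:R)) => L.
have q0 : (0 < q)%N by have := ltnW s2; rewrite sE muln_gt0 => /andP[].
have cp : (a L.+1 %/ q <= p)%N.
  by rewrite ltnW // ltn_divLR // -sE.
have -> : p%:R * value a - (a 1 %/ q)%N%:R - pvalue (mu p a) L =
    p%:R * (value a - pvalue a L) - (a L.+1 %/ q)%N%:R * (s%:R ^+ L)^-1.
  have : p%:R * (word a L)%:R + (a L.+1 %/ q)%N%:R =
         (a 1 %/ q)%N%:R * s%:R ^+ L + (word (mu p a) L)%:R :> R.
    by rewrite -natrX -!natrM -!natrD (word_mu _ _ p0 sE).
  move=> wE; rewrite /pvalue.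
  have -> : (word (mu p a) L)%:R = p%:R * (word a L)%:R +
      (a L.+1 %/ q)%N%:R - (a 1 %/ q)%N%:R * s%:R ^+ L :> R by rewrite wE; ring.
  by field; rewrite lt0r_neq0.
have /andP[v1 v2] := value_bounds a L.
have cp' : (a L.+1 %/ q)%N%:R <= p%:R :> R by rewrite ler_nat.
have := sX_gt0 L; rewrite -invr_gt0; move: (_^-1) v2 => S v2 S0.
move: (ler0n R p) (ler0n R (a L.+1 %/ q)%N) cp' => P0 c0 cp'.
rewrite ler_norml; apply/andP; split; nra.
Qed.

End Value.

(** * Passing between closeness of values and agreement of digits *)

Section CloseValues.
Context (R : realType) (s : nat) (s2 : (2 <= s)%N).
Implicit Types (a b : config s) (A : set (config s)).

Lemma iter_left_shift_inv a (n : nat) (k : int) :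
  iter n (@left_shift_inv s) a k = a (k - Posz n)%R.
Proof.
elim: n k => [|n IH] k; first by rewrite subr0.
rewrite iterS /left_shift_inv IH -addrA -opprD.
by rewrite -[in RHS]addn1 PoszD [(1 + _)%R]addrC.
Qed.

(* Positions [-N .. N] of [a] are positions [1 .. 2N+1] of its shift by [N+1]. *)
Lemma word_window a b (N : nat) :
  word (iter N.+1 (@left_shift_inv s) a) (N + N).+1 =
    word (iter N.+1 (@left_shift_inv s) b) (N + N).+1 ->
  forall k : int, (`|k| <= N)%N -> a k = b k.
Proof.
move=> /word_digits eqab k kN.
have /eqab : (0 < absz (k + Posz N.+1)%R <= (N + N).+1)%N by lia.
have -> : Posz (absz (k + Posz N.+1)%R) = (k + Posz N.+1)%R by lia.
by rewrite !iter_left_shift_inv addrK.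
Qed.

Lemma separating_window (g : nat -> config s) (M : nat) : injective g ->
  exists N : nat, forall i j : nat, (i < j <= M)%N ->
    exists2 k : int, (`|k| <= N)%N & g i k <> g j k.
Proof.
move=> ginj.
have /choice [k kP] : forall ij : nat * nat, exists k : int,
    ij.1 <> ij.2 -> g ij.1 k <> g ij.2 k.
  move=> [i j] /=; have [->|ij] := eqVneq i j; first by exists 0%R.
  have : g i <> g j by move=> /ginj ij'; rewrite ij' eqxx in ij.
  have [[k gk]|nk] := pselect (exists k, g i k <> g j k); first by exists k.
  by case; apply/funext => k; apply: contrapT => gk; apply: nk; exists k.
(* The farthest of the chosen coordinates at which two of the configurations differ. *)
exists (\max_(i < M.+1) \max_(j < M.+1) `|k (val i, val j)|)%N.
move=> i j /andP[ij jM].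
exists (k (i, j)); last by apply: (kP (i, j)) => /= ij'; rewrite ij' ltnn in ij.
have iM : (i < M.+1)%N by rewrite ltnS (leq_trans (ltnW ij)).
apply: leq_trans (leq_bigmax (Ordinal iM)).
by apply: leq_trans (leq_bigmax (Ordinal (jM : (j < M.+1)%N))).
Qed.

Local Open Scope ring_scope.

Let sX_gt0 (L : nat) : 0 < s%:R ^+ L :> R.
Proof. by rewrite exprn_gt0 // ltr0n ltnW. Qed.

Lemma word_le a b (L : nat) :
  pvalue R a L < pvalue R b L + (s%:R ^+ L)^-1 -> (word a L <= word b L)%N.
Proof.
rewrite /pvalue -[X in _ < _ + X]mul1r -mulrDl natr1 ltr_pM2r ?invr_gt0 //.
by rewrite ltr_nat ltnS.
Qed.

(* A real number has at most two expansions. *)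
Lemma word_of_value a b (L : nat) : value R a = value R b ->
  (value R a == pvalue R a L + (s%:R ^+ L)^-1) =
    (value R b == pvalue R b L + (s%:R ^+ L)^-1) ->
  word a L = word b L.
Proof.
move=> eqv; have /andP[a1 a2] := value_bounds R s2 a L.
have /andP[b1 b2] := value_bounds R s2 b L.
have := sX_gt0 L; rewrite -invr_gt0; set S := _^-1 => S0.
case: eqP => [aE /esym/eqP bE|aN /esym/eqP bN]; apply/eqP; rewrite eqn_leq.
  by rewrite !word_le //; rewrite -/S; lra.
have {}a2 : value R a < pvalue R a L + S.
  by rewrite lt_neqAle a2 andbT; apply/eqP.
have {}b2 : value R b < pvalue R b L + S.
  by rewrite lt_neqAle b2 andbT; apply/eqP.
by rewrite !word_le //; rewrite -/S; lra.
Qed.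

Lemma infinite_sequence (T : Type) (A : set T) : infinite_set A ->
  exists2 g : nat -> T, injective g & forall n, A (g n).
Proof.
move=> /infiniteP /card_leP [f]; exists (fun n => set_val (f (to_setT n))).
  by move=> i j /val_inj /inj-/(_ (mem_set I) (mem_set I)) /(congr1 val).
by move=> n; apply: set_valP.
Qed.

Lemma value_itv a : 0 <= value R a <= 1.
Proof.
by have := value_bounds R s2 a 0; rewrite /pvalue /= expr0 mul0r add0r invr1.
Qed.

(** Suppose that values in [A] closer than [e] are equal. Take [2 M + 1] configurations that differ
    pairwise on a window, and shift the window to positions [1 ... L]. Two of them share their cell
    of length [e] and the bit [upper]; they then have equal values, hence equal first [L] digits, a
    contradiction. *)
Lemma close_values A : infinite_set A ->
  (forall a, A a -> A (left_shift_inv a)) ->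
  forall e : R, 0 < e ->
  exists a b, [/\ A a, A b & 0 < `|value R a - value R b| < e].
Proof.
move=> /infinite_sequence [g ginj gA] Ainv e e0.
have shiftA a n : A a -> A (iter n (@left_shift_inv s) a).
  by move=> Aa; elim: n => //= n; apply: Ainv.
apply: contrapT => far.
have eq_of_close a b : A a -> A b -> `|value R a - value R b| < e ->
    value R a = value R b.
  move=> Aa Ab ab; apply/eqP; rewrite -subr_eq0 -normr_eq0.
  apply/negPn/negP => ab0.
  by apply: far; exists a, b; rewrite ab lt_def ab0 normr_ge0.
pose cell a : nat := Num.truncn (value R a / e).
pose M := (Num.truncn e^-1).+1.
have cellM a : (cell a < M)%N.
  rewrite ltnS; apply: le_truncn; have /andP[_] := value_itv a.
  by rewrite -{2}[e^-1]mul1r ler_pM2r ?invr_gt0.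
have [N sepN] := separating_window (M + M) ginj.
pose h n := iter N.+1 (@left_shift_inv s) (g n).
pose L := (N + N).+1.
(* This holds exactly when all digits after position [L] are [s - 1]; it tells the two expansions of
   a number apart. *)
pose upper a := value R a == pvalue R a L + (s%:R ^+ L)^-1.
have indexM n : (cell (h n) + (if upper (h n) then M else 0) < M + M)%N.
  by have := cellM (h n); case: ifP; lia.
have [i [j [ijM [eqij]]]] := nat_pigeonhole (fun n => Ordinal (indexM n)).
have [k kN gk] := sepN i j ijM; apply: gk.
apply: (word_window (N := N)) kN.
have [eqc equ] : cell (h i) = cell (h j) /\ upper (h i) = upper (h j).
  have := cellM (h i); have := cellM (h j); move: eqij.
  by case: (upper (h i)); case: (upper (h j)); lia.
apply: word_of_value => //; apply: eq_of_close; try exact: shiftA.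
have v0 a : 0 <= value R a / e.
  by have /andP[v _] := value_itv a; rewrite divr_ge0 // ltW.
have := truncn_itv (v0 (h i)); rewrite -/(cell _) eqc.
have := truncn_itv (v0 (h j)); rewrite -/(cell _).
rewrite -natr1 ler_pdivlMr // !ltr_pdivrMr // ler_pdivlMr //.
rewrite -/(h i) -/(h j); move: (_%:R) => c.
by rewrite ltr_norml => /andP[? ?] /andP[? ?]; apply/andP; split; nra.
Qed.

(* The midpoint of the cylinder of [c] has a neighbourhood of values whose
   expansions all start like [c]. *)
Lemma approx_of_dense A :
  (forall a, A a -> A (left_shift a)) ->
  (forall y, adherent
     [set x : R | exists a (n : int), A a /\ x = value R a + n%:~R] y) ->
  forall (c : config s) (N : nat),
  exists2 a, A a & forall k : int, (`|k| <= N)%N -> a k = c k.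
Proof.
move=> Ash dense c N; pose L := (N + N).+1.
pose c' := iter N.+1 (@left_shift_inv s) c.
have S0 : 0 < (s%:R ^+ L)^-1 :> R by rewrite invr_gt0.
have Sh : 0 < (s%:R ^+ L)^-1 / 2 :> R by lra.
have [_ [a [n [Aa ->]]]] := dense (pvalue R c' L + (s%:R ^+ L)^-1 / 2) _ Sh.
have F0 : 0 <= pvalue R c' L by rewrite divr_ge0 ?ler0n // ltW.
have F1 : pvalue R c' L + (s%:R ^+ L)^-1 <= 1.
  rewrite /pvalue -[X in _ + X]mul1r -mulrDl natr1 ler_pdivrMr // mul1r.
  rewrite -natrX ler_nat.
  by have /andP[_] := word_bounds c' 0 L; rewrite /= mul1n.
have /andP[v0 v1] := value_itv a.
(* The midpoint is at least half a cylinder away from 0 and 1, so [value R a + n] lies strictly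
   between them. *)
move=> near; have n0 : n = 0.
  have : (-1 < n)%R /\ (n < 1)%R; last lia.
  rewrite -!(ltr_int R) mulrNz; move: near; rewrite ltr_norml => /andP[? ?].
  by split; lra.
move: near; rewrite n0 addr0 ltr_norml => /andP[lo hi].
have /andP[b1 b2] := value_bounds R s2 a L.
exists (iter N.+1 (@left_shift s) a).
  by elim: (N.+1) => //= m; apply: Ash.
have invK m b : iter m (@left_shift_inv s) (iter m (@left_shift s) b) = b.
  elim: m => // m IH.
  by rewrite iterSr [iter m.+1 (@left_shift s) b]iterS left_shiftK IH.
move=> k; apply: word_window; rewrite invK -/c' -/L.
by apply/eqP; rewrite eqn_leq !word_le //; lra.
Qed.

End CloseValues.

(** * The semigroups of cellular automata *)

Lemma near_coordinate s (a : config s) (k : int) : \forall x \near a, x k = a k.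
Proof.
apply: (@proj_continuous int (fun=> discrete_topology 'I_s) k a
  [set i | i = a k]).
by rewrite nbhs_principalE.
Qed.

Lemma cvg_coordinates (T : Type) s (F : set_system T) {FF : Filter F}
    (u : T -> config s) (a : config s) :
  (forall k, \forall x \near F, u x k = a k) -> u x @[x --> F] --> a.
Proof.
move=> ua; apply/cvg_sup => k P; rewrite nbhsE => -[B [[C _ <-] Ca] CP].
by apply: filterS (ua k) => x uxk; apply: CP; rewrite /= uxk.
Qed.

Lemma continuous_coordinates s (f : config s -> config s) :
  (forall a k, \forall x \near a, f x k = f a k) -> continuous f.
Proof.
by move=> fP a; apply: (cvg_coordinates (F := nbhs a)) => k; apply: fP.
Qed.

Lemma closed_approx s (A : set (config s)) (c : config s) : closed A ->
  (forall N : nat, exists2 a, A a &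
     forall k : int, (`|k| <= N)%N -> a k = c k) ->
  A c.
Proof.
move=> clA approx.
have /choice [a aP] : forall N : nat, exists a,
    A a /\ forall k : int, (`|k| <= N)%N -> a k = c k.
  by move=> N; have [a Aa ac] := approx N; exists a.
apply: (@closed_cvg _ _ \oo _ a A clA).
  by apply: nearW => N; have [] := aP N.
apply: cvg_coordinates => k; near=> N.
by apply: (aP N).2; near: N; exists `|k|%N.
Unshelve. all: by end_near. Qed.

Lemma CAT_left_shift s : CAT (@left_shift s).
Proof.
split=> //; apply: continuous_coordinates => a k; exact: near_coordinate.
Qed.

Lemma CAT_left_shift_inv s : CAT (@left_shift_inv s).
Proof.
split; first by apply: continuous_coordinates => a k; exact: near_coordinate.
by apply/funext => a; rewrite /= left_shiftK left_shift_invK.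
Qed.

Lemma CAT_mu s p : CAT (@mu s p).
Proof.
split=> //; apply: continuous_coordinates => a k; near=> x.
have xk : x k = a k by near: x; apply: near_coordinate.
have xk1 : x (k + 1)%R = a (k + 1)%R by near: x; apply: near_coordinate.
by apply: val_inj; rewrite /= xk xk1.
Unshelve. all: by end_near. Qed.

Lemma CAT_semigroup s : is_semigroup (@CAT s).
Proof.
move=> f g [cf fs] [cg gs]; split.
  by move=> a; apply: continuous_comp; [apply: cg | apply: cf].
by rewrite -compA gs compA fs compA.
Qed.

Lemma Aut_semigroup s : is_semigroup (@Aut s).
Proof.
move=> f g [cf bf] [cg bg]; split; first exact: CAT_semigroup.
exact: bij_comp.
Qed.

Lemma generated_semigroup_sub (T : Type) (G S : set (T -> T)) :
  is_semigroup S -> G `<=` S -> generated_semigroup G `<=` S.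
Proof. by move=> semiS GS f; apply; split. Qed.

(* Dividing [s] into [p * q], the digit [d = q * c + r] of [a] is sent by [mu p]
   to the digit [p * r + c'], where [c'] comes from the next digit of [a]; hence
   [mu q] recovers [q * c' + r']. *)
Lemma mu_mu s p q (a : config s) : (0 < p)%N -> (0 < q)%N -> s = (p * q)%N ->
  mu q (mu p a) = left_shift a.
Proof.
move=> p0 q0 sE; have sE' : s = (q * p)%N by rewrite mulnC.
apply/funext => k; apply: val_inj.
rewrite [LHS](mu_digit _ _ q0 sE') !(mu_digit _ _ p0 sE).
have lt_c i : (a i %/ q < p)%N by rewrite ltn_divLR // -sE.
rewrite ![(p * _)%N]mulnC modnMDl modn_small // divnMDl //.
by rewrite (divn_small (lt_c _)) addn0 mulnC -divn_eq.
Qed.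

Lemma Aut_left_shift s : Aut (@left_shift s).
Proof.
split; first exact: CAT_left_shift.
by exists (@left_shift_inv s); [apply: left_shiftK | apply: left_shift_invK].
Qed.

Lemma Aut_left_shift_inv s : Aut (@left_shift_inv s).
Proof.
split; first exact: CAT_left_shift_inv.
by exists (@left_shift s); [apply: left_shift_invK | apply: left_shiftK].
Qed.

Lemma Aut_mu s p : (0 < s)%N -> (p %| s)%N -> Aut (@mu s p).
Proof.
move=> s0 /dvdnP[q sE]; split; first exact: CAT_mu.
have [q0 p0] : (0 < q)%N /\ (0 < p)%N by apply/andP; rewrite -muln_gt0 -sE.
have sE' : s = (p * q)%N by rewrite mulnC.
(* The left inverse comes from [mu_mu]; it is also a right inverse because [mu p] commutes with the
   shift. *)
exists (@left_shift_inv s \o @mu s q) => a /=.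
  by rewrite mu_mu // left_shiftK.
have [_ mus] := CAT_mu s p.
rewrite -[LHS]left_shiftK -[left_shift (mu p _)]/((@left_shift s \o @mu s p) _).
by rewrite -mus /= left_shift_invK mu_mu // left_shiftK.
Qed.

(** If [j > 0], then [s] divides a power of the prime [p], hence is one. *)
Lemma prime_mul_independent p s : prime p -> (1 < s)%N ->
  ~ (exists k : nat, s = (p ^ k)%N) -> mul_independent p s.
Proof.
move=> pp s1 npow i [|j] eqps.
  by apply/eqP; move/eqP: eqps; rewrite expn0 -(expn0 p) eqn_exp2l ?prime_gt1.
have /dvdn_pfactor [] // : (s %| p ^ i)%N by rewrite eqps expnS dvdn_mulr.
by move=> k _ sE; case: npow; exists k.
Qed.

Lemma finite_invariant (R : realType) s p (A : set (config s)) :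
  (2 <= s)%N -> prime p -> (p %| s)%N -> ~ (exists k : nat, s = (p ^ k)%N) ->
  closed A -> (forall a, A a -> A (mu p a)) ->
  (forall a, A a -> A (left_shift a)) ->
  (forall a, A a -> A (left_shift_inv a)) ->
  A <> setT -> finite_set A.
Proof.
move=> s2 pp /dvdnP[q] sE npow clA Amu Ash Ainv AT; apply: contrapT => infA.
have {}sE : s = (p * q)%N by rewrite mulnC.
apply: AT; rewrite -subTset => c _; apply: closed_approx => // N.
apply: (approx_of_dense (R := R) s2 Ash).
pose E := [set x : R | exists a (n : int), A a /\ x = (value R a + n%:~R)%R].
have EA a (n : int) : A a -> E (value R a + n%:~R)%R by move=> Aa; exists a, n.
apply: (furstenberg (prime_gt1 pp) s2 (prime_mul_independent pp s2 npow)).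
- by move=> _ n [a [m [Aa ->]]]; exists a, (m + n)%R; rewrite intrD addrA.
- move=> _ [a [m [Aa ->]]].
  (* The integer part restores the carry that [value_mu] subtracts. *)
  exists (mu p a), (Posz (a 1%R %/ q)%N + Posz p * m)%R.
  split; first exact: Amu.
  by rewrite (value_mu R s2 _ (prime_gt0 pp) sE) intrD intrM -!pmulrn; ring.
- move=> _ [a [m [Aa ->]]].
  exists (left_shift a), (Posz (a 1%R) + Posz s * m)%R.
  split; first exact: Ash.
  by rewrite (value_left_shift R s2) intrD intrM -!pmulrn; ring.
- move=> e e0; have [a [b [Aa Ab ab]]] := close_values s2 infA Ainv e0.
  exists (value R a), (value R b).
  by split => //; [exists a, 0%R | exists b, 0%R]; rewrite addr0.
Qed.

End Expansions.

Theorem theorem5p1 (s : nat) (hs : (2 <= s)%N) :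
  (forall p : nat, prime p -> (p %| s)%N ->
     ~ (exists k : nat, s = (p ^ k)%N) ->
     is_ID_semigroup
       (generated_semigroup [set @mu s p; @left_shift s; @left_shift_inv s])) /\
  (~ (exists q k : nat, prime q /\ s = (q ^ k)%N) ->
     is_ID_semigroup (@Aut s)).
Proof.
have finite_inv (S : set (config s -> config s)) p : prime p -> (p %| s)%N ->
    ~ (exists k : nat, s = (p ^ k)%N) ->
    [set @mu s p; @left_shift s; @left_shift_inv s] `<=` S ->
    forall A : set (config s), closed A -> invariant_under S A -> A <> setT ->
    finite_set A.
  move=> pp ps npow GS A clA invA.
  have inv f : S f -> forall a, A a -> A (f a).
    by move=> Sf a Aa; apply: (invA f Sf); exists a.
  (* The conclusion does not mention real numbers, so a concrete model is chosen here. *)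
  apply: (finite_invariant (Rdefinitions.R : realType) hs pp ps npow clA) => //.
  - by apply/inv/GS; left; left.
  - by apply/inv/GS; left; right.
  - by apply/inv/GS; right.
split=> [p pp ps npow | npow].
- split; last 2 first.
  + by move=> f g Gf Gg S SG; apply: SG.1; [apply: Gf | apply: Gg].
  + by apply: (finite_inv _ p) => // f Gf S [_ GS]; apply: GS.
  apply: generated_semigroup_sub; first exact: CAT_semigroup.
  move=> _ [[->|->]|->]; [exact: CAT_mu | exact: CAT_left_shift |].
  exact: CAT_left_shift_inv.
- split; [by move=> f [] | exact: Aut_semigroup |].
  (* Any prime divisor of [s] would do, since [s] is a power of no prime. *)
  apply: (finite_inv _ (pdiv s)); [exact: pdiv_prime | exact: pdiv_dvd | |].
    move=> [k sE]; apply: npow; exists (pdiv s), k.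
    by split=> //; exact: pdiv_prime.
  move=> _ [[->|->]|->]; [apply: Aut_mu | exact: Aut_left_shift |].
  - exact: ltnW.
  - exact: pdiv_dvd.
  - exact: Aut_left_shift_inv.
Qed.
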